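(* Let $p\ge1$ be an integer, $\mathcal{L}=\{l_i\}_{i=0}^{2p-1}$ a layering (of permutations of $\{1,\dots,2p\}$), $r=\frac{1}{\sqrt{2p}}$ and $t=\sqrt{1-r^2}=\sqrt{\frac{2p-1}{2p}}$. Then there exists a distance symmetric set of $2p$ points $\{\xi_i\}_{i=1}^{2p}$ in $t\,\mathbb{S}^{2p-2}$ with associated layering $\mathcal{L}$, i.e. with $$|\xi_j-\xi_{l_i(j)}| = 2\sqrt{i}\,r \quad\text{for all } j\in\{1,\dots,2p\},\ i\in\{0,\dots,2p-1\},$$ if and only if the spectral gap $\lambda_G$ of the Laplacian of the graph $G_{\mathcal{L}}$ associated to the layering satisfies $$\lambda_G \ge p(2p-1).$$
   Context: $t\,\mathbb{S}^{2p-2}$ is the sphere of radius $t$ centered at the origin in $\mathbb{R}^{2p-1}$. Layering: for $N\ge1$, a layering is a family $\{l_i\}_{i=0}^{N-1}$ of permutations of $\{1,\dots,N\}$ such that (1) $l_0(j)=j$ for all $j$; (2) $l_i(1)=i+1$ for all $i$; (3) for all $i\ne k$ and all $j$, $l_i(j)\neq l_k(j)$; (4) $l_i^{-1}=l_i$ for all $i$. Its distance function is $d_{ij}$ = the unique integer with $l_{d_{ij}}(i)=j$ (so $d_{ii}=0$ and $d_{ij}=d_{ji}$). The graph $G_{\mathcal{L}}$ of a layering with $N=2p$ is the complete graph on vertices $v_1,\dots,v_{2p}$ with edge weights $w(\{v_i,v_j\})=d_{ij}$. Its adjacency matrix $A$ has entries $A_{ij}=d_{ij}$ for $i\ne j$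 and $A_{ii}=0$; its degree matrix $D$ is diagonal with $D_{ii}=\sum_{j\neq i} d_{ij}$; its Laplacian is $L=D-A$. The spectral gap $\lambda_G$ is the second smallest eigenvalue of $L$ (counted with multiplicity). *)

(* Defs.v *)
From mathcomp Require Import all_boot all_order all_algebra all_fingroup.
From mathcomp Require Import polyrcf.
From mathcomp Require Import reals.

Set Implicit Arguments.
Unset Strict Implicit.
Unset Printing Implicit Defensive.

Import Order.TTheory GRing.Theory Num.Theory.

Local Open Scope ring_scope.

(* The set {1, ..., N} is represented by 'I_N = {0, ..., N-1}: the element j
   of {1, ..., N} is the ordinal of value j - 1. The index set
   {0, ..., N-1} of the family is 'I_N without any shift. Under this
   convention, the axiom l_i(1) = i + 1 says that l i sends the ordinal of
   value 0 to i. *)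
Record layering (N : nat) (l : 'I_N -> {perm 'I_N}) : Prop := Layering {
  layering_id : forall i j : 'I_N, nat_of_ord i = 0%N -> l i j = j;
  layering_first : forall i j : 'I_N, nat_of_ord j = 0%N -> l i j = i;
  layering_disj : forall i k : 'I_N, i != k -> forall j, l i j != l k j;
  layering_inv : forall i : 'I_N, (l i)^-1%g = l i
}.

(* The integer k such that l_k(i) = j; the default value 0 is never used for
   a layering, see layer_dist_unique. *)
Definition layer_dist (N : nat) (l : 'I_N -> {perm 'I_N}) (i j : 'I_N) : nat :=
  if [pick k | l k i == j] is Some k then nat_of_ord k else 0%N.

Lemma layer_dist_unique N (l : 'I_N -> {perm 'I_N}) : layering l ->
  forall i j k : 'I_N, l k i = j <-> layer_dist l i j = k.
Proof.
move=> hl i j k.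
have inj : injective (fun k => l k i).
  move=> k1 k2 /eqP; apply: contraTeq => /(layering_disj hl) -> //.
rewrite /layer_dist; case: pickP => [k' /eqP hk'|h].
  split=> [hk|/val_inj <- //].
  by congr nat_of_ord; apply: inj; rewrite /= hk' hk.
have [g _ gK] := injF_bij inj.
by move: (h (g j)); rewrite /= gK eqxx.
Qed.

Section Graph.
Variables (R : realType) (n : nat) (w : 'I_n -> 'I_n -> R).

Definition adjacency_mx : 'M[R]_n := \matrix_(i, j) if i == j then 0 else w i j.

Definition degree_mx : 'M[R]_n := diag_mx (\row_i \sum_(j | j != i) w i j).

Definition laplacian_mx : 'M[R]_n := degree_mx - adjacency_mx.
End Graph.

Definition layering_laplacian (R : realType) (N : nat)
    (l : 'I_N -> {perm 'I_N}) : 'M[R]_N :=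
  laplacian_mx (fun i j => (layer_dist l i j)%:R).

Section Spectrum.
Variables (R : realType) (n : nat) (M : 'M[R]_n).

(* rootsR lists the distinct real roots in increasing order; each one is
   repeated according to its multiplicity. *)
Definition real_spectrum : seq R :=
  flatten [seq nseq (mup x (char_poly M)) x | x <- rootsR (char_poly M)].

Lemma count_real_spectrum x : count_mem x real_spectrum = mup x (char_poly M).
Proof.
have p0 : char_poly M != 0 by apply/monic_neq0/char_poly_monic.
rewrite /real_spectrum count_flatten -map_comp sumnE big_map.
have us : uniq (rootsR (char_poly M)).
  exact: (sorted_uniq lt_trans ltxx (sorted_roots _ _ _)).
have E y : (count_mem x \o (fun x => nseq (mup x (char_poly M)) x)) y =
    if y == x then mup x (char_poly M) else 0%N.
  by rewrite /= count_nseq /=; case: eqVneq => [->|_]; rewrite ?mul1n.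
under eq_bigr do rewrite E.
rewrite -big_mkcond /=.
have [xr|xnr] := boolP (x \in rootsR (char_poly M)).
  by rewrite -big_filter filter_pred1_uniq // big_seq1.
rewrite big_seq_cond big1 => [|i /andP[ir /eqP ix]]; last first.
  by rewrite -ix ir in xnr.
apply/esym/mupNroot; apply: contra xnr => rx.
by rewrite -(roots_on_rootsR p0) rx andbT in_itv.
Qed.

Lemma real_spectrum_sorted : sorted <=%R real_spectrum.
Proof.
rewrite /real_spectrum.
have : sorted <%R (rootsR (char_poly M)) by exact: sorted_roots.
elim: (rootsR _) => //= x s IH hs.
rewrite (sorted_pairwise le_trans) pairwise_cat -!(sorted_pairwise le_trans).
rewrite (IH (path_sorted hs)) andbT; apply/andP; split.
  apply/allrelP => y z /nseqP[-> _] /flattenP[t /mapP[u us ->]] /nseqP[-> _].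
  by move: hs; rewrite (path_sortedE lt_trans) => /andP[/allP/(_ u us)/ltW].
by case: (mup x _) => //= k; elim: k => //= k ->; rewrite lexx.
Qed.

(* The second smallest eigenvalue, counted with multiplicity. *)
Definition spectral_gap : R := real_spectrum`_1.
End Spectrum.

(* The norm `|_| of the library on row vectors is the sup norm. *)
Definition enorm (R : realType) (n : nat) (u : 'rV[R]_n) : R :=
  Num.sqrt (\sum_i u 0 i ^+ 2).

(* xi is a set of N distinct points of the sphere of radius t of R^n which is
   distance symmetric, with associated layering l and distance unit 2 r. *)
Definition distance_symmetric (R : realType) (n N : nat) (r t : R)
    (l : 'I_N -> {perm 'I_N}) (xi : 'I_N -> 'rV[R]_n) : Prop :=
  [/\ injective xi,
      forall j, enorm (xi j) = t &
      forall i j : 'I_N,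
        enorm (xi j - xi (l i j)) = 2 * Num.sqrt (i%:R) * r].

(* Main.v *)
Require Import Defs.
From mathcomp Require Import all_boot all_order all_algebra all_fingroup.
From mathcomp Require Import complex ring lra zify.
From mathcomp Require Import reals.

Set Implicit Arguments.
Unset Strict Implicit.
Unset Printing Implicit Defensive.

Import Order.TTheory GRing.Theory Num.Theory.

Local Open Scope ring_scope.

(** Write N for the number of points, d_ij for the layering distance, A for the
matrix (d_ij) and J for the all-ones matrix. Expanding |xi_i - xi_j|^2 shows
that distance symmetry with layering l on the sphere of radius t says exactly
that the Gram matrix of the points is G = t^2 J - 2 r^2 A
([distance_symmetric_gramP]). So the question is whether G is the Gram matrix
of N vectors of R^(N-1), that is, whether G is positive semidefinite of rank
at most N - 1.

For fixed i, j |-> d_ij takes each value 0, ..., N-1 once, so every vertex of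
the graph has degree c = N (N-1) / 2 and L = c I - A
([layering_laplacianE]). Hence G = (t^2 J - 2 r^2 c I) + 2 r^2 L is diagonal in
any orthonormal basis that diagonalizes L and starts with the normalized
constant vector. On the constant vector G has eigenvalue N t^2 - 2 r^2 c, which
the choice t^2 = (N-1) r^2 makes 0: this is the dimension that is saved. On
each other basis vector, with L-eigenvalue d_k, the eigenvalue of G is
2 r^2 (d_k - c) ([layering_gram_diag]). So the points exist if and only if
d_k >= c for all k >= 1.

Since L kills the constant vector and c > 0, exactly one of the eigenvalues
0, d_1, ..., d_(N-1) of L lies below c when all d_k >= c, and at least two do
otherwise. In terms of the sorted spectrum this says that the second entry is
at least c ([spectral_gap_geP]).

The diagonalization is the spectral theorem for real symmetric matrices with a
prescribed first eigenvector ([symmetric_diagonalization]). A real eigenvector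
comes from a complex one, and a reflection that moves the first basis vector to
the prescribed one reduces the dimension by one. *)

(** * The standard inner product of row vectors *)

Section RowProduct.
Variable R : realDomainType.

Definition dot n (u v : 'rV[R]_n) : R := \sum_i u 0 i * v 0 i.

Lemma dotE n (u v : 'rV[R]_n) : dot u v = (u *m v^T) 0 0.
Proof. by rewrite mxE; apply: eq_bigr => i _; rewrite mxE. Qed.

Lemma mulmx_tr_dot n (u v : 'rV[R]_n) : u *m v^T = (dot u v)%:M.
Proof. by rewrite dotE -mx11_scalar. Qed.

Lemma dotC n (u v : 'rV[R]_n) : dot u v = dot v u.
Proof. by apply: eq_bigr => i _; rewrite mulrC. Qed.

Lemma dotDl n (u v w : 'rV[R]_n) : dot (u + v) w = dot u w + dot v w.
Proof. by rewrite !dotE mulmxDl mxE. Qed.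

Lemma dotZl n a (u v : 'rV[R]_n) : dot (a *: u) v = a * dot u v.
Proof. by rewrite !dotE -scalemxAl mxE. Qed.

Lemma dot_mulmx m n (u : 'rV[R]_m) (A : 'M_(m, n)) v :
  dot (u *m A) v = dot u (v *m A^T).
Proof. by rewrite !dotE trmx_mul trmxK mulmxA. Qed.

Lemma dot_ge0 n (u : 'rV[R]_n) : 0 <= dot u u.
Proof. by apply: sumr_ge0 => i _; rewrite -expr2 sqr_ge0. Qed.

Lemma dot_eq0 n (u : 'rV[R]_n) : (dot u u == 0) = (u == 0).
Proof.
apply/eqP/eqP => [u0|->]; last first.
  by rewrite /dot big1 // => i _; rewrite mxE mul0r.
apply/rowP => i; rewrite mxE; apply/eqP; rewrite -sqrf_eq0 expr2.
by move/psumr_eq0P: u0 => -> // j _; rewrite -expr2 sqr_ge0.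
Qed.

Lemma dotBB n (u v : 'rV[R]_n) :
  dot (u - v) (u - v) = dot u u + dot v v - 2 * dot u v.
Proof.
rewrite /dot mulr_sumr -big_split -sumrB; apply: eq_bigr => i _.
by rewrite !mxE /=; ring.
Qed.

End RowProduct.

(** * Orthogonal diagonalization of real symmetric matrices *)

(** Over the algebraically closed field R[i] there is an eigenvector x + i y
with eigenvalue a + i b, and then x A = a x - b y and y A = a y + b x. As A is
symmetric, <x A, y> = <y A, x>, which reads b (|x|^2 + |y|^2) = 0. So b = 0, and
x and y satisfy the eigenvector equation for a; one of them is not zero. *)
Lemma symmetric_eigenvector (R : rcfType) n (A : 'M[R]_n.+1) : A^T = A ->
  exists a (u : 'rV_n.+1), u != 0 /\ u *m A = a *: u.
Proof.
move=> symA; pose Ac := map_mx (real_complex R) A.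
have /closed_rootP [z] : size (char_poly Ac) != 1%N by rewrite size_char_poly.
rewrite -eigenvalue_root_char => /eigenvalueP [v vA v0].
pose x : 'rV[R]_n.+1 := map_mx (@complex.Re R) v.
pose y : 'rV[R]_n.+1 := map_mx (@complex.Im R) v.
have xA : x *m A = complex.Re z *: x + (- complex.Im z) *: y.
  apply/rowP => j; have /rowP/(_ j)/(congr1 (@complex.Re R)) := vA.
  rewrite /x /y !mxE raddf_sum /=; case: (z) (v 0 j) => a b [c d] /= E.
  under eq_bigr => i _ do rewrite mxE.
  rewrite (eq_bigr (fun i => complex.Re (v 0 i * Ac i j))) => [|i _].
    by rewrite E; ring.
  by rewrite mxE; case: (v 0 i) => e f /=; ring.
have yA : y *m A = complex.Re z *: y + complex.Im z *: x.
  apply/rowP => j; have /rowP/(_ j)/(congr1 (@complex.Im R)) := vA.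
  rewrite /x /y !mxE raddf_sum /=; case: (z) (v 0 j) => a b [c d] /= E.
  under eq_bigr => i _ do rewrite mxE.
  rewrite (eq_bigr (fun i => complex.Im (v 0 i * Ac i j))) => [|i _].
    by rewrite E; ring.
  by rewrite mxE; case: (v 0 i) => e f /=; ring.
have xy0 : (x != 0) || (y != 0).
  rewrite -negb_and; apply: contra v0 => /andP[/eqP x0 /eqP y0].
  apply/eqP/rowP => j; have /rowP/(_ j) := x0; have /rowP/(_ j) := y0.
  by rewrite !mxE; case: (v 0 j) => e f /= -> ->.
have im0 : complex.Im z = 0.
  have : dot (x *m A) y = dot (y *m A) x by rewrite dot_mulmx symA dotC.
  rewrite xA yA !dotDl !dotZl (dotC y x) => H.
  have /eqP : complex.Im z * (dot x x + dot y y) = 0 by lra.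
  rewrite mulf_eq0 paddr_eq0 ?dot_ge0 // !dot_eq0.
  by rewrite -[X in _ || X]negbK negb_and xy0 orbF => /eqP.
exists (complex.Re z); case/orP: xy0 => [x0|y0]; [exists x | exists y].
  by rewrite xA im0 oppr0 scale0r addr0.
by rewrite yA im0 scale0r addr0.
Qed.

Definition reflection_mx (R : realFieldType) n (v : 'rV[R]_n) : 'M[R]_n :=
  1%:M - (2 / dot v v) *: (v^T *m v).

Lemma reflection_mx_orthogonal (R : realFieldType) n (v : 'rV[R]_n) :
  v != 0 -> reflection_mx v *m (reflection_mx v)^T = 1%:M.
Proof.
rewrite -dot_eq0 => v0.
have -> : (reflection_mx v)^T = reflection_mx v.
  by rewrite linearB linearZ /= trmx_mul trmxK trmx1.
rewrite /reflection_mx; move: (dot v v) v0 (mulmx_tr_dot v v) => s s0 vv.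
rewrite mulmxBl mul1mx mulmxBr mulmx1 -!scalemxAl -!scalemxAr.
rewrite mulmxA -(mulmxA v^T v) vv mul_mx_scalar -scalemxAl !scalerA.
have -> : 2 / s * (2 / s * s) = 2 / s + 2 / s by field.
by rewrite scalerDl opprB addrK subrK.
Qed.

(** Householder: the reflection in the direction e_0 - u exchanges the unit
vectors e_0 and u. *)
Lemma orthogonal_completion (R : realFieldType) n (u : 'rV[R]_n.+1) :
  dot u u = 1 -> exists H : 'M_n.+1, H *m H^T = 1%:M /\ row 0 H = u.
Proof.
move=> u1; pose e : 'rV[R]_n.+1 := delta_mx 0 0.
have eH (M : 'M[R]_n.+1) : e *m M = row 0 M by rewrite rowE.
have [ue|ue] := eqVneq u e.
  by exists 1%:M; rewrite trmx1 mulmx1 -eH mulmx1.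
pose v := e - u.
have v0 : v != 0 by rewrite subr_eq0 eq_sym.
have vv0 : dot v v != 0 by rewrite dot_eq0.
have e1 : dot e e = 1 by rewrite dotE -rowE !mxE eqxx.
have vvE : dot v v = 2 * dot e v.
  by rewrite dotBB e1 u1 (dotC e v) dotDl -scaleN1r dotZl e1 dotC; ring.
exists (reflection_mx v); split; first exact: reflection_mx_orthogonal.
rewrite -eH mulmxBr mulmx1 -scalemxAr mulmxA mulmx_tr_dot mul_scalar_mx scalerA.
by rewrite mulrAC -vvE divff // scale1r /v opprB addrC subrK.
Qed.

Lemma row0_mul_eigen (R : comPzRingType) n (Q A : 'M[R]_n.+1) a :
  Q *m Q^T = 1%:M -> row 0 Q *m A = a *: row 0 Q ->
  row 0 (Q *m A *m Q^T) = a *: delta_mx 0 0.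
Proof.
by move=> QQ uA; rewrite !row_mul uA -scalemxAl -row_mul QQ row1.
Qed.

(** In an orthonormal basis that starts with u the matrix is block diagonal
with blocks (a) and C, and C is again symmetric. The induction hypothesis
applies to C with any unit eigenvector that C has. Prescribing u is what lets
the Laplacian and the all-ones matrix be diagonalized together. *)
Theorem symmetric_diagonalization (R : rcfType) n (A : 'M[R]_n.+1) a
    (u : 'rV_n.+1) :
  A^T = A -> dot u u = 1 -> u *m A = a *: u ->
  exists (Q : 'M_n.+1) (d : 'rV_n.+1),
    [/\ Q *m Q^T = 1%:M, row 0 Q = u & Q *m A *m Q^T = diag_mx d].
Proof.
elim: n => [|n IH] in A a u *.
  move=> _ u1 uA; exists u, (row 0 (u *m A *m u^T)); split.
  - by rewrite mulmx_tr_dot u1.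
  - by apply/rowP => i; rewrite mxE.
  - by apply/matrixP => i j; rewrite !ord1 !mxE eqxx.
move=> symA u1 uA; have [H [HH H0]] := orthogonal_completion u1.
pose B : 'M_(1 + n.+1) := H *m A *m H^T.
have B0 : row 0 B = a *: delta_mx 0 0 by apply: row0_mul_eigen; rewrite ?H0.
have symB : B^T = B by rewrite !trmx_mul trmxK symA mulmxA.
have B0j j : B 0 j = a * (j == 0)%:R.
  by have /rowP/(_ j) := B0; rewrite [LHS]mxE => ->; rewrite !mxE.
have ord00 : lshift n.+1 (0 : 'I_1) = 0 by apply/val_inj.
have Bul : ulsubmx B = a%:M.
  by apply/matrixP => i j; rewrite !ord1 2![LHS]mxE ord00 B0j mxE eqxx mulr1.
have Bur : ursubmx B = 0.
  by apply/matrixP => i j; rewrite ord1 2![LHS]mxE ord00 B0j [RHS]mxE mulr0.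
have Bdl : dlsubmx B = 0.
  by rewrite -[dlsubmx B]trmxK trmx_dlsub symB Bur trmx0.
have symC : (drsubmx B)^T = drsubmx B by rewrite trmx_drsub symB.
have [b [v [v0 vC]]] := symmetric_eigenvector symC.
pose v' := (Num.sqrt (dot v v))^-1 *: v.
have v'1 : dot v' v' = 1.
  rewrite dotZl dotC dotZl mulrA -invfM -expr2 sqr_sqrtr ?dot_ge0 // mulVf //.
  by rewrite dot_eq0.
have v'C : v' *m drsubmx B = b *: v'.
  by rewrite -scalemxAl vC scalerA mulrC -scalerA.
have [Q [d [QQ _ Qd]]] := IH _ _ _ symC v'1 v'C.
pose P : 'M[R]_(1 + n.+1) := block_mx 1%:M 0 0 Q.
have PP : P *m P^T = 1%:M.
  rewrite /P tr_block_mx mulmx_block !trmx0 trmx1 !mulmx0 !mul0mx !mulmx1 QQ.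
  by rewrite !addr0 add0r -scalar_mx_block.
have PBP : P *m B *m P^T = diag_mx (row_mx a%:M d).
  rewrite -[B]submxK Bul Bur Bdl /P tr_block_mx !mulmx_block.
  rewrite !trmx0 trmx1 !mulmx0 !mul0mx !mulmx1 !mul1mx !addr0 !add0r Qd.
  rewrite mul0mx diag_mx_row; congr block_mx.
  by apply/matrixP => i k; rewrite !ord1 !mxE.
have P0 : row 0 P = delta_mx 0 0.
  apply/rowP => k; rewrite !mxE; case: splitP => // i _; rewrite mxE ord1.
  by case: splitP => m km; rewrite ?ord1 mxE eqxx -val_eqE /= km ?ord1.
exists (P *m H), (row_mx a%:M d); split.
- by rewrite trmx_mul mulmxA -(mulmxA P) HH mulmx1.
- by rewrite row_mul P0 -rowE.
- by rewrite trmx_mul !mulmxA -(mulmxA P) -(mulmxA P) -/B.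
Qed.

(** * The sorted spectrum of an orthogonally diagonalized matrix *)

Lemma char_poly_orthogonal_diag (R : comNzRingType) n (Q A : 'M[R]_n) d :
  Q *m Q^T = 1%:M -> Q *m A *m Q^T = diag_mx d ->
  char_poly A = \prod_(i < n) ('X - (d 0 i)%:P).
Proof.
move=> QQ QAQ.
transitivity (char_poly (diag_mx d)); last first.
  rewrite char_poly_trig ?diag_mx_is_trig //.
  by apply: eq_bigr => i _; rewrite mxE eqxx.
rewrite -QAQ /char_poly /char_poly_mx !map_mxM /= -map_trmx.
set P := map_mx polyC Q.
have PP : P *m P^T = 1%:M by rewrite map_trmx -map_mxM QQ map_mx1.
set Ap := map_mx polyC A.
have -> : 'X%:M - P *m Ap *m P^T = P *m ('X%:M - Ap) *m P^T.
  by rewrite mulmxBr mulmxBl mul_mx_scalar -scalemxAl PP scalemx1.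
by rewrite !det_mulmx mulrAC -det_mulmx PP det1 mul1r.
Qed.

Lemma mup_prod_XsubC (R : fieldType) x (s : seq R) :
  mup x (\prod_(a <- s) ('X - a%:P)) = count_mem x s.
Proof.
elim: s => [|a s IH]; first by rewrite big_nil mupNroot ?root1.
rewrite big_cons mupM ?polyXsubC_eq0 //; last first.
  by rewrite monic_neq0 // monic_prod_XsubC.
by rewrite IH -['X - _]expr1 mup_XsubCX /= eq_sym.
Qed.

Lemma real_spectrum_orthogonal_diag (R : realType) n (Q A : 'M[R]_n) d :
  Q *m Q^T = 1%:M -> Q *m A *m Q^T = diag_mx d ->
  perm_eq (real_spectrum A) [seq d 0 i | i <- enum 'I_n].
Proof.
move=> QQ QAQ; apply/allP => x _ /=; rewrite count_real_spectrum.
rewrite (char_poly_orthogonal_diag QQ QAQ) -mup_prod_XsubC big_map.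
by rewrite enumT.
Qed.

Lemma sorted_le_nth1 (R : realDomainType) (s : seq R) c :
  sorted <=%R s -> (1 < size s)%N -> (c <= s`_1) = (count (< c) s <= 1)%N.
Proof.
case: s => [|a [|b s]] //= /andP[ab bs] _.
have [cb|bc] := leP c b.
  have -> : count (< c) s = 0%N.
    apply/eqP; rewrite -leqn0 leqNgt -has_count; apply/hasPn => x xs.
    rewrite -leNgt (le_trans cb) //.
    by move: bs; rewrite (path_sortedE le_trans) => /andP[/allP/(_ x xs)].
  by rewrite !addn0; case: (_ < _).
by rewrite (le_lt_trans ab bc).
Qed.


(** Both sides say that at most one eigenvalue lies below c, since d_0 is
one of them. *)
Lemma spectral_gap_geP (R : realType) n (Q A : 'M[R]_n.+1) d c :
  (0 < n)%N -> Q *m Q^T = 1%:M -> Q *m A *m Q^T = diag_mx d -> d 0 0 < c ->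
  c <= spectral_gap A <-> forall k, c <= d 0 (lift 0 k).
Proof.
move=> n0 QQ QA d0.
have pe := real_spectrum_orthogonal_diag QQ QA.
rewrite /spectral_gap sorted_le_nth1 ?real_spectrum_sorted //; last first.
  by rewrite (perm_size pe) size_map size_enum_ord.
rewrite (seq.permP pe) enum_ordSl /= d0 -map_comp count_map.
rewrite -[X in (_ <= X)%N]addn0 leq_add2l leqn0 eqn0Ngt -has_count; split.
  move/hasPn=> h k; have := h k; rewrite mem_enum => /(_ isT) /=.
  by rewrite -leNgt.
by move=> h; apply/hasPn => k _ /=; rewrite -leNgt.
Qed.

(** * Layering distances *)

Section LayeringDistance.
Variables (N : nat) (l : 'I_N -> {perm 'I_N}).
Hypothesis hl : layering l.

Lemma layer_inj i : injective (fun k => l k i).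
Proof. by move=> k1 k2 /eqP; apply: contraTeq => /(layering_disj hl) ->. Qed.

Lemma layer_distE k i : layer_dist l i (l k i) = k.
Proof. exact/layer_dist_unique. Qed.

Lemma layer_distP i j : exists k, j = l k i.
Proof.
by have [g _ gK] := injF_bij (@layer_inj i); exists (g j); rewrite gK.
Qed.

Lemma layer_dist_sym i j : layer_dist l i j = layer_dist l j i.
Proof.
have [k ->] := layer_distP i j; rewrite layer_distE.
apply/esym/(layer_dist_unique hl); rewrite -{1}(layering_inv hl).
by rewrite permK.
Qed.

Lemma layer_dist_eq0 i j : (layer_dist l i j == 0%N) = (i == j).
Proof.
pose k0 : 'I_N := Ordinal (leq_ltn_trans (leq0n i) (ltn_ord i)).
have lk0 m : l k0 m = m by apply: (layering_id hl).
apply/eqP/eqP => [d0|<-]; last by have := layer_distE k0 i; rewrite lk0.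
by rewrite -(lk0 i); apply/(layer_dist_unique hl).
Qed.

(** The values d_ij, for fixed i, are 0, ..., N-1 in some order. The factor 2
avoids a division in nat. *)
Lemma sum_layer_dist i : (2 * \sum_j layer_dist l i j = N * N.-1)%N.
Proof.
rewrite (reindex_inj (@layer_inj i)) /=.
under eq_bigr do rewrite layer_distE.
rewrite -(big_mkord xpredT id) bin2_sum bin2 mul2n halfK.
by case: N => // n; rewrite oddM /= andNb subn0.
Qed.

End LayeringDistance.

(** * The Laplacian and the Gram matrix of a layering *)

Section LayeringLaplacian.
Variables (R : realType) (n : nat) (l : 'I_n.+1 -> {perm 'I_n.+1}).
Hypothesis hl : layering l.

Let D : 'M[R]_n.+1 := \matrix_(i, j) (layer_dist l i j)%:R.
Let c : R := (n.+1 * n)%:R / 2.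

Lemma layering_laplacianE : layering_laplacian R l = c%:M - D.
Proof.
apply/matrixP => i j; rewrite !mxE.
have Dii : (layer_dist l i i)%:R = 0 :> R.
  by apply/eqP; rewrite pnatr_eq0 layer_dist_eq0.
congr (_ - _); last by case: eqP => // <-.
have [_|_] := eqVneq i j; rewrite ?mulr1n ?mulr0n //.
rewrite /c -(sum_layer_dist hl i) natrM mulrC mulKf ?pnatr_eq0 // natr_sum.
by rewrite [RHS](bigD1 i) //= Dii add0r.
Qed.

Lemma const_layering_laplacian a :
  const_mx a *m layering_laplacian R l = 0 :> 'rV_n.+1.
Proof.
apply/rowP => j; rewrite layering_laplacianE mulmxBr mul_mx_scalar !mxE.
under eq_bigr do rewrite !mxE (layer_dist_sym hl).
rewrite -mulr_sumr mulrC -mulrBr -natr_sum /c -(sum_layer_dist hl j) natrM.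
by rewrite mulrC mulrAC mulfV ?pnatr_eq0 // mul1r subrr mul0r.
Qed.

Lemma layering_laplacian_sym :
  (layering_laplacian R l)^T = layering_laplacian R l.
Proof.
rewrite layering_laplacianE linearB /= tr_scalar_mx; congr (_ - _).
by apply/matrixP => i j; rewrite !mxE (layer_dist_sym hl).
Qed.

Lemma layering_laplacian_diag :
  exists (Q : 'M[R]_n.+1) (d : 'rV[R]_n.+1),
    [/\ Q *m Q^T = 1%:M, row 0 Q = const_mx (Num.sqrt n.+1%:R)^-1,
        d 0 0 = 0 & Q *m layering_laplacian R l *m Q^T = diag_mx d].
Proof.
pose u : 'rV[R]_n.+1 := const_mx (Num.sqrt n.+1%:R)^-1.
have u1 : dot u u = 1.
  rewrite /dot; under eq_bigr do rewrite !mxE.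
  rewrite sumr_const card_ord -invfM -expr2 sqr_sqrtr ?ler0n //.
  by rewrite -[LHS]mulr_natr mulVf ?pnatr_eq0.
have uL : u *m layering_laplacian R l = 0 *: u.
  by rewrite scale0r const_layering_laplacian.
have [Q [d [QQ Q0 QL]]] :=
  symmetric_diagonalization layering_laplacian_sym u1 uL.
exists Q, d; split=> //.
have /rowP/(_ 0) : row 0 (diag_mx d) = 0.
  by rewrite -QL !row_mul Q0 uL scale0r mul0mx.
by rewrite !mxE eqxx mulr1n.
Qed.

(** The matrix diagonalized here is the Gram matrix that the points must have.
The all-ones matrix is a multiple of the projection on the first row of Q, so
it contributes only to the first entry, where the relation between t and r
makes everything cancel. *)
Lemma layering_gram_diag (Q : 'M[R]_n.+1) (d : 'rV_n.+1) (r t : R) :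
  Q *m Q^T = 1%:M -> row 0 Q = const_mx (Num.sqrt n.+1%:R)^-1 -> d 0 0 = 0 ->
  Q *m layering_laplacian R l *m Q^T = diag_mx d ->
  t ^+ 2 = n%:R * r ^+ 2 ->
  Q *m (const_mx (t ^+ 2) - (2 * r ^+ 2) *: D) *m Q^T =
  diag_mx (\row_k if k == 0 then 0 else 2 * r ^+ 2 * (d 0 k - c)).
Proof.
move=> QQ Q0 d0 QL htr; set u := row 0 Q in Q0.
have JE : const_mx (t ^+ 2) = (t ^+ 2 * n.+1%:R) *: (u^T *m u).
  apply/matrixP => i j; rewrite Q0 !mxE big_ord1 !mxE -invfM -expr2.
  by rewrite sqr_sqrtr ?ler0n // mulfK ?pnatr_eq0.
have uQ : u *m Q^T = delta_mx 0 0 by rewrite /u -row_mul QQ row1.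
have QJ : Q *m const_mx (t ^+ 2) *m Q^T = (t ^+ 2 * n.+1%:R) *: delta_mx 0 0.
  have Qu : Q *m u^T = delta_mx 0 0.
    by rewrite -[LHS]trmxK trmx_mul trmxK uQ trmx_delta.
  by rewrite JE -scalemxAr -scalemxAl (mulmxA Q) Qu -mulmxA uQ mul_delta_mx.
have -> : D = c%:M - layering_laplacian R l.
  by rewrite layering_laplacianE opprB addrCA subrr addr0.
rewrite mulmxBr mulmxBl QJ -scalemxAr -scalemxAl mulmxBr mulmxBl QL.
rewrite mul_mx_scalar -scalemxAl QQ.
apply/matrixP => i j; rewrite !mxE; have [->|i0] := eqVneq i 0.
  rewrite d0; have [_|_] := eqVneq j 0; rewrite ?mulr1n ?mulr0n ?mulr0 ?subr0.
    by rewrite htr /c natrM; field.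
  by rewrite ?mulr0 ?subrr.
have [->|ij] := eqVneq i j; rewrite ?mulr1n ?mulr0n.
  by ring.
by rewrite !mulr0 subrr mulr0 subr0.
Qed.

End LayeringLaplacian.

(** * Distance symmetry as a condition on the Gram matrix *)

Section Gram.
Variables (R : realType) (n N : nat) (r t : R) (l : 'I_N -> {perm 'I_N}).
Hypotheses (hl : layering l) (r0 : 0 < r) (t0 : 0 <= t).

Lemma enormE (u : 'rV[R]_n) : enorm u = Num.sqrt (dot u u).
Proof. by congr Num.sqrt; apply: eq_bigr => i _; rewrite expr2. Qed.

Lemma sqr_enorm (u : 'rV[R]_n) : enorm u ^+ 2 = dot u u.
Proof. by rewrite enormE sqr_sqrtr ?dot_ge0. Qed.

(** By polarization the inner products and the distances determine each other
once the norms are t. The points given by such inner products are distinct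
because d_ij vanishes only on the diagonal and r is not 0. *)
Lemma distance_symmetric_gramP (xi : 'I_N -> 'rV[R]_n) :
  distance_symmetric r t l xi <->
  forall i j, dot (xi i) (xi j) = t ^+ 2 - 2 * r ^+ 2 * (layer_dist l i j)%:R.
Proof.
split=> [[_ ht hd] i j|G].
  have [k ->] := layer_distP hl i j; rewrite layer_distE //.
  have := congr1 (fun x => x ^+ 2) (hd k i).
  rewrite /= sqr_enorm !exprMn sqr_sqrtr ?ler0n // dotBB -!sqr_enorm !ht.
  by move=> E; lra.
have Gii i : dot (xi i) (xi i) = t ^+ 2.
  have /eqP di : layer_dist l i i == 0%N by rewrite layer_dist_eq0.
  by rewrite G di mulr0 subr0.
split=> [i j ij|j|k j].
- apply/eqP; rewrite -(layer_dist_eq0 hl) -(pnatr_eq0 R).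
  have := G i j; rewrite -ij Gii => /eqP; rewrite -subr_eq0 opprB addrC subrK.
  have r2 : 2 * r ^+ 2 != 0 by rewrite mulf_neq0 ?pnatr_eq0 ?expf_neq0 ?gt_eqF.
  by rewrite mulf_eq0 (negbTE r2).
- by rewrite enormE Gii sqrtr_sqr ger0_norm.
rewrite enormE dotBB !Gii G layer_distE //.
have -> : t ^+ 2 + t ^+ 2 - 2 * (t ^+ 2 - 2 * r ^+ 2 * k%:R) =
          (2 * Num.sqrt k%:R * r) ^+ 2.
  by rewrite !exprMn sqr_sqrtr ?ler0n //; ring.
by rewrite sqrtr_sqr ger0_norm // !mulr_ge0 ?sqrtr_ge0 // ltW.
Qed.

End Gram.

(** * The spectral criterion *)

(** The criterion holds for every number N = n + 1 > 1 of points, even or odd,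
and for every radius and distance unit related by t^2 = n r^2. The diagonal
entry of Q G Q^T at an index k >= 1 is the squared norm of the k-th row of Q X
when G = X X^T, hence is nonnegative. Conversely, Q^T and the square roots of
these entries give the factor X, and the index 0, whose entry is 0, can be
dropped: the points then lie in R^n. *)
Theorem distance_symmetric_spectral_gap (R : realType) (n : nat)
    (l : 'I_n.+1 -> {perm 'I_n.+1}) (r t : R) :
  (0 < n)%N -> layering l -> 0 < r -> 0 <= t -> t ^+ 2 = n%:R * r ^+ 2 ->
  (exists xi : 'I_n.+1 -> 'rV[R]_n, distance_symmetric r t l xi)
  <-> (n.+1 * n)%:R / 2 <= spectral_gap (layering_laplacian R l).
Proof.
move=> n0 hl r0 t0 htr; set c := _ / 2.
have c0 : 0 < c by rewrite divr_gt0 // ltr0n muln_gt0.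
have [Q [d [QQ Q0 d0 QL]]] := layering_laplacian_diag R hl.
have QtQ : Q^T *m Q = 1%:M by apply: mulmx1C.
rewrite (spectral_gap_geP (c := c) n0 QQ QL) ?d0 //.
have := layering_gram_diag hl QQ Q0 d0 QL htr.
set G := const_mx _ - _; set g := \row_k _ => QG.
have GE i j : G i j = t ^+ 2 - 2 * r ^+ 2 * (layer_dist l i j)%:R.
  by rewrite !mxE.
split=> [[xi /(distance_symmetric_gramP hl r0 t0) xiG] k|hd].
  pose X : 'M[R]_(n.+1, n) := \matrix_i xi i.
  have XX : G = X *m X^T.
    apply/matrixP => i j; rewrite GE -xiG mxE.
    by apply: eq_bigr => m _; rewrite !mxE.
  have : 0 <= g 0 (lift 0 k).
    have /matrixP/(_ (lift 0 k) (lift 0 k)) := QG.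
    rewrite XX -!mulmxA -trmx_mul mulmxA [RHS]mxE eqxx mulr1n => <-.
    rewrite mxE; apply: sumr_ge0 => m _.
    by rewrite [X in _ * X]mxE -expr2 sqr_ge0.
  by rewrite mxE /= pmulr_rge0 ?subr_ge0 // mulr_gt0 // exprn_gt0.
have [s ss] : exists s, forall k, s k * s k = g 0 (lift 0 k).
  exists (fun k => Num.sqrt (g 0 (lift 0 k))) => k; rewrite -expr2 sqr_sqrtr //.
  by rewrite mxE /= mulr_ge0 ?subr_ge0 // mulr_ge0 // exprn_ge0 // ltW.
exists (fun i => \row_k (s k * Q (lift 0 k) i)).
apply/(distance_symmetric_gramP hl r0 t0) => i j; rewrite -GE.
have -> : G = Q^T *m diag_mx g *m Q.
  by rewrite -QG !mulmxA QtQ mul1mx -mulmxA QtQ mulmx1.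
(* The term of index 0 vanishes with g 0 0. *)
rewrite mul_mx_diag mxE big_ord_recl [X in X + _](_ : _ = 0) ?add0r; last first.
  by rewrite !mxE eqxx mulr0 mul0r.
apply: eq_bigr => k _; rewrite [X in _ = X * _]mxE [Q^T _ _]mxE -ss !mxE.
by ring.
Qed.

Theorem theorem5p4 (R : realType) (p : nat) (hp : (1 <= p)%N)
    (l : 'I_(2 * p) -> {perm 'I_(2 * p)}) (hl : layering l) (r t : R)
    (hr : r = (Num.sqrt (2 * p)%:R)^-1) (ht : t = Num.sqrt (1 - r ^+ 2)) :
  (exists xi : 'I_(2 * p) -> 'rV[R]_(2 * p - 1), distance_symmetric r t l xi)
  <-> (p * (2 * p - 1))%:R <= spectral_gap (layering_laplacian R l).
Proof.
(* Here n = 2 p - 1, and n.+1 n / 2 = p (2 p - 1). *)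
have -> : (p * (2 * p - 1))%:R = (2 * p * (2 * p - 1))%:R / 2 :> R.
  by rewrite -mulnA (natrM _ 2) mulrAC mulfV ?mul1r ?pnatr_eq0.
have n0 : (0 < 2 * p - 1)%N by lia.
have N0 : (2 * p = (2 * p - 1).+1)%N by lia.
move: (2 * p - 1)%N n0 N0 => n n0 N0; move: l hl hr; rewrite N0 => l hl hr.
have r2 : r ^+ 2 = n.+1%:R^-1 by rewrite hr exprVn sqr_sqrtr ?ler0n.
have t2 : t ^+ 2 = n%:R * r ^+ 2.
  rewrite ht sqr_sqrtr r2.
    by rewrite -natr1; field; rewrite natr1 pnatr_eq0.
  by rewrite subr_ge0 invf_le1 ?ltr0n // ler1n.
apply: distance_symmetric_spectral_gap => //; last by rewrite ht sqrtr_ge0.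
by rewrite hr invr_gt0 sqrtr_gt0 ltr0n.
Qed.
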